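(* Let $(G,m,w,B)$ be a connected weighted finite graph with boundary, with vertex set $V$ and interior $\Omega=V\setminus B$. Suppose that there is a nonnegative function $\rho\in\mathbb{R}^\Omega$ such that $w_{xy}=\rho_y m_x m_y$ for any $x\in B$ and $y\in\Omega$, and that $$\mu_2(\Omega)\ge \mathrm{Deg}-V_B\,\rho_{\min}+\frac{V_G}{\mathrm{Deg}}\langle\rho,\rho\rangle_\Omega,$$ where $\mu_2(\Omega)$ is the second Laplacian eigenvalue of the induced weighted graph of $G$ on $\Omega$, $\mathrm{Deg}:=\langle\rho,1\rangle_\Omega$ (which equals the weighted degree $\mathrm{Deg}(x)$ of every $x\in B$), $\rho_{\min}=\min_{y\in\Omega}\rho_y$, $V_B=\sum_{x\in B}m_x$ and $V_G=\sum_{x\in V}m_x$. Then $\sigma_i=\mu_i$ for all $i=1,2,\dots,|B|$, where $\mu_i$ and $\sigma_i$ are the Laplacian and Steklov eigenvalues of $(G,m,w,B)$.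
   Context: A weighted graph $(G,m,w)$ consists of a finite, simple, connected graph $G$ with vertex set $V$ and edge set $E$, a positive function $m$ on $V$ (vertex measure, written $m_x$), and a positive function $w$ on $E$ (edge weight), regarded as a symmetric function $w_{xy}$ on $V\times V$ by setting $w_{xy}=0$ when $\{x,y\}\notin E$. The weighted degree of $x\in V$ is $\mathrm{Deg}(x)=\frac1{m_x}\sum_{y\in V}w_{xy}$. Graph with boundary: $(G,m,w,B)$ is a weighted graph together with a nonempty set $B\subset V$ (the boundary) such that no two vertices of $B$ are adjacent and every vertex of $B$ is adjacent to some vertex of $\Omega:=V\setminus B$ (the interior). Laplacian: for $u\in\mathbb{R}^V$, $\Delta u(x)=\frac1{m_x}\sum_{y\in V}(u(y)-u(x))w_{xy}$. The operator $-\Delta$ is nonnegative and self-adjoint for $\langle u,v\rangle=\sum_{x\in V}u(x)v(x)m_x$; its eigenvalues, counted with multiplicity, are $0=\mu_1<\mu_2\le\cdots\le\mu_{|V|}$. Steklov eigenvalues: for $f\in\mathbb{R}^B$ let $u_f\in\mathbb{R}^V$ be the unique function with $u_f=f$ on $B$ and $\Delta u_f=0$ on $\Omega$. The Dirichlet-to-Neumann map $\Lambda:\mathbb{R}^B\to\mathbb{R}^B$ is $\Lambda f(x)=\frac{\partial u_f}{\partial n}(x)$, where $\frac{\partial u}{\partial n}(x)=\frac1{m_x}\sum_{y\in V}(u(x)-u(y))w_{xy}$ for $x\in B$. It is nonnegative and self-adjoint for $\langle f,g\rangle_B=\sum_{x\in B}f(x)g(x)m_x$; its eigenvalues, counted with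 multiplicity, are $0=\sigma_1<\sigma_2\le\cdots\le\sigma_{|B|}$. Notation: $\langle u,v\rangle_\Omega=\sum_{x\in\Omega}u(x)v(x)m_x$. The induced weighted graph on $\Omega$ has vertex set $\Omega$, the edges of $G$ with both endpoints in $\Omega$, and the restrictions of $m$ and $w$; it need not be connected. $\mu_2(\Omega)$ is the second smallest eigenvalue (with multiplicity) of its Laplacian $u\mapsto -\frac{1}{m_x}\sum_{y\in\Omega}(u(y)-u(x))w_{xy}$ on $\mathbb{R}^\Omega$. If $|\Omega|=1$, the condition on $\mu_2(\Omega)$ is regarded as vacuously satisfied ($\mu_2(\Omega)=+\infty$). *)

(* Defs.v *)
From mathcomp Require Import all_boot all_order all_algebra.
From mathcomp Require Import polyrcf.
From mathcomp Require Import all_classical all_reals.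

Set Implicit Arguments.
Unset Strict Implicit.
Unset Printing Implicit Defensive.

Import Order.TTheory GRing.Theory Num.Theory.
Local Open Scope ring_scope.

(* Connectedness is kept out of the record, because the graph induced on the
   interior is a weighted graph that need not be connected. *)
Record wgraph (R : realType) (V : finType) := WGraph {
  edge : rel V;
  vmeas : V -> R;
  ewgt : V -> V -> R;
  edge_sym : symmetric edge;
  edge_irr : irreflexive edge;
  vmeas_gt0 : forall x, 0 < vmeas x;
  ewgt_sym : forall x y, ewgt x y = ewgt y x;
  ewgt_gt0 : forall x y, edge x y -> 0 < ewgt x y;
  ewgt_eq0 : forall x y, ~~ edge x y -> ewgt x y = 0
}.

Definition connected_wgraph (R : realType) (V : finType) (G : wgraph R V) :=
  forall x y : V, connect (edge G) x y.

Notation vset A := {x | x \in A}.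

Definition induced (R : realType) (V : finType) (G : wgraph R V)
    (A : {set V}) : wgraph R (vset A) :=
  @WGraph R (vset A)
    (fun x y => edge G (val x) (val y))
    (fun x => vmeas G (val x))
    (fun x y => ewgt G (val x) (val y))
    (fun x y => edge_sym G (val x) (val y))
    (fun x => edge_irr G (val x))
    (fun x => vmeas_gt0 G (val x))
    (fun x y => ewgt_sym G (val x) (val y))
    (fun x y => @ewgt_gt0 R V G (val x) (val y))
    (fun x y => @ewgt_eq0 R V G (val x) (val y)).

Definition is_boundary (R : realType) (V : finType) (G : wgraph R V)
    (B : {set V}) : Prop :=
  [/\ B != finset.set0,
      (forall x y, x \in B -> y \in B -> ~~ edge G x y) &
      (forall x, x \in B -> exists2 y, y \in ~: B & edge G x y)].

Definition inner (R : realType) (V : finType) (G : wgraph R V)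
    (u v : {ffun V -> R}) : R :=
  \sum_x u x * v x * vmeas G x.

Definition volume (R : realType) (V : finType) (G : wgraph R V)
    (A : {set V}) : R :=
  \sum_(x in A) vmeas G x.

Definition laplacian (R : realType) (V : finType) (G : wgraph R V)
    (u : {ffun V -> R}) : {ffun V -> R} :=
  [ffun x => (vmeas G x)^-1 * \sum_y (u y - u x) * ewgt G x y].

Definition neg_laplacian (R : realType) (V : finType) (G : wgraph R V)
    (u : {ffun V -> R}) : {ffun V -> R} :=
  [ffun x => - laplacian G u x].

Definition normal_deriv (R : realType) (V : finType) (G : wgraph R V)
    (u : {ffun V -> R}) (x : V) : R :=
  (vmeas G x)^-1 * \sum_y (u x - u y) * ewgt G x y.

Definition is_harmonic_ext (R : realType) (V : finType) (G : wgraph R V)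
    (B : {set V}) (f : {ffun vset B -> R}) (u : {ffun V -> R}) : Prop :=
  (forall x : vset B, u (val x) = f x) /\
  (forall y, y \in ~: B -> laplacian G u y = 0).

(* The default value of [xget] is irrelevant: on a connected graph with
   boundary the harmonic extension exists and is unique. *)
Definition harmonic_ext (R : realType) (V : finType) (G : wgraph R V)
    (B : {set V}) (f : {ffun vset B -> R}) : {ffun V -> R} :=
  xget [ffun => 0] (is_harmonic_ext G f).

Definition DtN (R : realType) (V : finType) (G : wgraph R V)
    (B : {set V}) (f : {ffun vset B -> R}) : {ffun vset B -> R} :=
  [ffun x => normal_deriv G (harmonic_ext G f) (val x)].

(* Matrix of a linear operator in the basis of indicator functions, with the
   row-vector convention of [matrix]: row i is the image of the i-th basis
   function. *)
Definition op_mx (R : realType) (X : finType)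
    (T : {ffun X -> R} -> {ffun X -> R}) : 'M[R]_#|X| :=
  \matrix_(i, j) T [ffun x => (x == enum_val i)%:R] (enum_val j).

(* [rootsR] lists the distinct real roots in increasing order, so the result is
   the nondecreasing list of the real eigenvalues, each repeated according to
   its (algebraic) multiplicity. *)
Definition eigenvalues (R : realType) (X : finType)
    (T : {ffun X -> R} -> {ffun X -> R}) : seq R :=
  let p := char_poly (op_mx T) in
  flatten [seq nseq (mup a p) a | a <- rootsR p].

(* Eigenvalues are numbered from 1. *)
Definition laplacian_eig (R : realType) (V : finType) (G : wgraph R V)
    (i : nat) : R :=
  nth 0 (eigenvalues (neg_laplacian G)) i.-1.

Definition steklov_eig (R : realType) (V : finType) (G : wgraph R V)
    (B : {set V}) (i : nat) : R :=
  nth 0 (eigenvalues (@DtN R V G B)) i.-1.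

(* A one-vertex graph has no second eigenvalue: +oo makes lower bounds on it
   vacuously true. *)
Definition mu2 (R : realType) (V : finType) (G : wgraph R V) : \bar R :=
  if #|V| == 1%N then +oo%E else (laplacian_eig G 2)%:E.

(* The default 0 is only reached when X is empty. *)
Definition fmin (R : realType) (X : finType) (f : {ffun X -> R}) : R :=
  if [pick y : X] is Some y0 then f [arg min_(y < y0) f y]%O else 0.

(* Main.v *)
(* Functions on [B] with zero mean, extended by zero to the interior, are at once
   Laplacian and Steklov eigenfunctions with eigenvalue [Deg]; together with the
   constants they account for the whole Steklov spectrum [0, Deg, ..., Deg].
   On the Laplacian side it remains to see that the other eigenvalues are at
   least [Deg], i.e. that the Dirichlet form dominates [Deg] times the variance.
   After subtracting the mean over the interior, the form splits into the energy
   across the boundary, which is an explicit quadratic expression because the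
   weights factor as [rho_y m_x m_y], and the interior energy, bounded below by
   [mu_2(Omega)]; Cauchy-Schwarz and completing a square then give the bound. *)
Require Import Defs.
From mathcomp Require Import all_boot all_order all_algebra.
From mathcomp Require Import complex polyrcf ring lra.
From mathcomp Require Import all_classical all_reals.

Set Implicit Arguments.
Unset Strict Implicit.
Unset Printing Implicit Defensive.

Import Order.TTheory GRing.Theory Num.Theory.
Local Open Scope ring_scope.

(** * Determinants and characteristic polynomials *)

(** The rows of [P] in [S] are eigenvectors, so multiplying the characteristic matrix by [P] leaves
    a factor ['X - a] in each of them; the determinant collects these factors, and [\det P] is a
    nonzero constant. *)
Lemma char_poly_exp_dvd (F : fieldType) n (A P : 'M[F]_n) (S : {set 'I_n}) a :
  P \in unitmx -> (forall i, i \in S -> row i (P *m A) = a *: row i P) ->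
  ('X - a%:P) ^+ #|S| %| char_poly A.
Proof.
move=> Pu eigP.
pose d : 'rV[{poly F}]_n := \row_i (if i \in S then 'X - a%:P else 1).
pose Q : 'M[{poly F}]_n :=
  \matrix_(i, j) if i \in S then (P i j)%:P else (map_mx polyC P *m char_poly_mx A) i j.
have PE : map_mx polyC P *m char_poly_mx A = diag_mx d *m Q.
  apply/matrixP => i j; rewrite mul_diag_mx [RHS]mxE [d 0 i]mxE [Q i j]mxE.
  case: ifP => iS; last by rewrite mul1r.
  rewrite /char_poly_mx.
  rewrite mulmxBr -map_mxM.
  rewrite mul_mx_scalar !mxE /=; move/rowP/(_ j): (eigP i iS); rewrite !mxE => ->.
  by rewrite polyCM mulrBl.
have := congr1 determinant PE; rewrite !det_mulmx det_diag det_map_mx -/(char_poly A).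
rewrite (bigID (mem S)) /= [X in _ * X * _]big1; last by move=> i /negPf iS; rewrite mxE iS.
rewrite (eq_bigr (fun=> 'X - a%:P)); last by move=> i iS; rewrite mxE iS.
rewrite prodr_const mulr1 => detE.
have dP0 : \det P != 0 by move: Pu; rewrite unitmxE unitfE.
by rewrite -(dvdpZr _ _ dP0) -mul_polyC detE dvdp_mulr.
Qed.

(* Sylvester's identity, multiplied by [a] so that [a] need not be a unit. *)
Lemma det_scalar_sub_rank1 (R : comNzRingType) n (a : R) (c : 'cV[R]_n) (r : 'rV[R]_n) :
  a * \det (a%:M - c *m r) = a ^+ n * (a - (r *m c) 0 0).
Proof.
(* The determinant of [M] is computed twice, clearing [r] by column operations and then by row
   operations; the latter also scale the last row by [a]. *)
pose M := block_mx a%:M c r (1%:M : 'M_1).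
have E1 : M *m block_mx 1%:M 0 (- r) 1%:M = block_mx (a%:M - c *m r) c 0 1%:M.
  by rewrite mulmx_block !mulmx1 !mulmx0 !mul1mx mulmxN addrN !add0r.
have E2 : block_mx 1%:M 0 (- r) a%:M *m M = block_mx a%:M c 0 (a%:M - r *m c).
  rewrite mulmx_block !mul1mx !mul0mx !addr0 mulmx1 mulNmx mul_mx_scalar mul_scalar_mx addNr.
  by rewrite addrC mulNmx.
have := congr1 determinant E1; rewrite det_mulmx det_lblock det_ublock !det1 !mulr1 => <-.
have := congr1 determinant E2; rewrite det_mulmx det_lblock det_ublock !det1 mul1r !det_scalar expr1 => ->.
by rewrite det_mx11 !mxE mulr1n.
Qed.

(* Since [r (X - A) = X r], [X (X - A - a c r)] factors as [(X - a c r) (X - A)]. *)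
Lemma char_poly_deflation (F : fieldType) n (A : 'M[F]_n) (c : 'cV[F]_n) (r : 'rV[F]_n) a :
  r *m A = 0 -> (r *m c) 0 0 = 1 ->
  char_poly (A + a *: (c *m r)) * 'X = char_poly A * ('X - a%:P).
Proof.
move=> rA rc.
pose c' := a%:P *: map_mx polyC c; pose r' := map_mx polyC r.
have E : 'X *: char_poly_mx (A + a *: (c *m r)) = ('X%:M - c' *m r') *m char_poly_mx A.
  have -> : char_poly_mx (A + a *: (c *m r)) = char_poly_mx A - c' *m r'.
    rewrite /char_poly_mx map_mxD opprD addrA; congr (_ - _).
    by rewrite -scalemxAl -map_mxM map_mxZ.
  rewrite mulmxBl mul_scalar_mx scalerBr; congr (_ - _).
  rewrite -mulmxA [r' *m _]mulmxBr -map_mxM rA map_mx0 subr0 mul_mx_scalar.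
  by rewrite scalemxAr.
have := congr1 determinant E; rewrite detZ det_mulmx -!/(char_poly _) => E1.
have := det_scalar_sub_rank1 'X c' r'.
have -> : (r' *m c') 0 0 = a%:P.
  by rewrite -scalemxAr -map_mxM !mxE; move: rc; rewrite !mxE => ->; rewrite mulr1.
move=> E2; apply: (mulfI (x := 'X^n)); first by rewrite expf_neq0 ?polyX_eq0.
by rewrite mulrA E1 mulrC mulrA E2 -mulrA [in RHS]mulrCA mulrA mulrC mulrCA mulrC -mulrA.
Qed.

(** * Spectral lower bounds for symmetric and weighted self-adjoint forms *)

Section Spectral.
Local Open Scope sesquilinear_scope.
Variable (R : rcfType) (n : nat).
Implicit Types (S : 'M[R]_n) (v : 'rV[R]_n).

(** Over [R[i]] the matrix is Hermitian and the spectral theorem diagonalizes it; in the eigenbasis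
    the form is a sum of eigenvalues times squared moduli. *)
Lemma symmetric_form_ge S (K : R) v : S^T = S ->
  (forall a, root (char_poly S) a -> K <= a) ->
  K * (v *m v^T) 0 0 <= (v *m S *m v^T) 0 0.
Proof.
move=> Ssym rootS; set f : {rmorphism R -> R[i]} := real_complex R.
have conjf m p (M : 'M[R]_(m, p)) : map_mx Num.conj (map_mx f M) = map_mx f M.
  by apply/matrixP => i j; rewrite !mxE; apply: conjc_real.
pose A := map_mx f S.
have Aherm : A \is hermsymmx.
  by apply/is_hermitianmxP; rewrite expr0 scale1r map_trmx Ssym conjf.
have /orthomx_spectralP := hermitian_normalmx Aherm.
set P := spectralmx A; set d := spectral_diag A => AE.
have PU : P \is unitarymx := spectral_unitarymx A.
have Pinv := invmx_unitary PU.
have dreal := hermitian_spectral_diag_real Aherm.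
(* Row [i] of the unitary [P] is a nonzero eigenvector for the real number [d 0 i], and roots
   transfer back along the embedding [f]. *)
have dge i : f K <= d 0 i.
  have /complex_realP[r] : d 0 i \is Num.real by exact: (mxOverP dreal).
  rewrite -[r%:C%C]/(f r) => dr.
  rewrite dr [_ <= _]lecR; apply: rootS.
  rewrite -(fmorph_root f) map_char_poly -eigenvalue_root_char -/A.
  apply/eigenvalueP; exists (row i P).
    rewrite -dr AE -row_mul !mulmxA mulmxV ?unitarymx_unit // mul1mx.
    by rewrite row_mul row_diag_mx -scalemxAl -rowE.
  apply: contra_neq (oner_neq0 R[i]) => Pi0.
  by have /rowP/(_ i) := congr1 (row i) (unitarymxP PU); rewrite row_mul Pi0 mul0mx !mxE eqxx.
pose w := map_mx f v *m P ^t*.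
have wt : w ^t* = P *m map_mx f v^T.
  by rewrite /w trmx_mul map_mxM trmxCK map_trmx conjf.
rewrite -lecR rmorphM /= -!/(f _).
have fE (M : 'M[R]_1) : f (M 0 0) = (map_mx f M) 0 0 by rewrite mxE.
rewrite !fE !map_mxM -/A AE Pinv !mulmxA -/w -[w *m _ *m P *m _]mulmxA -wt.
have -> : map_mx f v *m map_mx f v^T = w *m w ^t*.
  by rewrite wt /w mulmxA -(mulmxA _ _ P) -Pinv mulVmx ?unitarymx_unit // mulmx1.
rewrite mul_mx_diag !mxE mulr_sumr; apply: ler_sum => i _.
have -> : w ^t* i 0 = (w 0 i)^* by rewrite mxE; congr (_^*); rewrite mxE.
rewrite [X in _ <= X * _]mxE [X in _ <= X]mulrAC [X in _ <= X]mulrC.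
by apply: ler_wpM2r; [exact: mul_conjC_ge0 | exact: dge].
Qed.

Implicit Type A : 'M[R]_n.

(** With [D] the diagonal matrix of square roots of [m], conjugating [A] by [D] gives a symmetric
    matrix with the same eigenvalues; the weighted form of [A] at [v] is its plain form at
    [v *m D]. *)
Lemma selfadjoint_form_ge A (m : 'I_n -> R) (K : R) v :
  (forall i, 0 < m i) -> (forall i j, A i j * m j = A j i * m i) ->
  (forall a, root (char_poly A) a -> K <= a) ->
  K * (\sum_i v 0 i ^+ 2 * m i) <= \sum_i (v *m A) 0 i * v 0 i * m i.
Proof.
move=> m0 Asym rootA.
have s0 i : Num.sqrt (m i) != 0 by rewrite gt_eqF // sqrtr_gt0.
have ss i : Num.sqrt (m i) * Num.sqrt (m i) = m i by rewrite -expr2 sqr_sqrtr // ltW.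
pose D : 'M[R]_n := diag_mx (\row_i Num.sqrt (m i)); pose D' : 'M[R]_n := diag_mx (\row_i (Num.sqrt (m i))^-1).
have DD' : D *m D' = 1%:M.
  apply/matrixP => i j; rewrite mul_diag_mx !mxE.
  by case: eqVneq => [->|]; rewrite ?mulr0n ?mulr0 // mulr1n divff.
have D'D := mulmx1C DD'.
have Ssym : (D' *m A *m D)^T = D' *m A *m D.
  apply/matrixP => i j; rewrite mxE mul_mx_diag mul_diag_mx !mxE.
  apply: (mulfI (s0 i)); apply: (mulfI (s0 j)).
  have As : A i j * (Num.sqrt (m j) * Num.sqrt (m j)) = A j i * (Num.sqrt (m i) * Num.sqrt (m i)) by rewrite !ss.
  have -> : Num.sqrt (m j) * (Num.sqrt (m i) * ((Num.sqrt (m j))^-1 * A j i * Num.sqrt (m i))) =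
     A j i * (Num.sqrt (m i) * Num.sqrt (m i)) by field.
  by rewrite -As; field.
have := @symmetric_form_ge (D' *m A *m D) K (v *m D) Ssym.
have rootS a : root (char_poly (D' *m A *m D)) a -> K <= a.
  rewrite -eigenvalue_root_char => /eigenvalueP[u uS u0]; apply: rootA.
  rewrite -eigenvalue_root_char; apply/eigenvalueP; exists (u *m D').
    have := congr1 (mulmx^~ D') uS.
    by rewrite /= -!mulmxA DD' mulmx1 -scalemxAl.
  by apply: contra_neq u0 => uD; rewrite -[u]mulmx1 -D'D mulmxA uD mul0mx.
have uD (u : 'rV[R]_n) i : (u *m D) 0 i = u 0 i * Num.sqrt (m i).
  by rewrite mul_mx_diag !mxE.
move/(_ rootS); rewrite !mulmxA -(mulmxA v D D') DD' mulmx1 [X in _ * X]mxE [X in _ <= X]mxE.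
congr (_ * _ <= _); apply: eq_bigr => i _; rewrite [_^T _ _]mxE !uD mulrACA ss //.
Qed.

Lemma root_char_poly_ge A (m : 'I_n -> R) (K : R) :
  (forall i, 0 < m i) ->
  (forall v, K * (\sum_i v 0 i ^+ 2 * m i) <= \sum_i (v *m A) 0 i * v 0 i * m i) ->
  forall a, root (char_poly A) a -> K <= a.
Proof.
move=> m0 formA a; rewrite -eigenvalue_root_char => /eigenvalueP[v vA v0].
have := formA v; rewrite vA.
have -> : \sum_i (a *: v) 0 i * v 0 i * m i = a * \sum_i v 0 i ^+ 2 * m i.
  by rewrite mulr_sumr; apply: eq_bigr => i _; rewrite mxE; ring.
rewrite ler_pM2r // lt_def sumr_ge0 ?andbT; last first.
  by move=> i _; rewrite mulr_ge0 ?sqr_ge0 // ltW.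
apply: contra_neq v0 => /eqP; rewrite psumr_eq0 => [/allP v0|i _].
  apply/rowP => i; have := v0 i (mem_index_enum _); rewrite /= mulf_eq0 expf_eq0 /=.
  by rewrite (gt_eqF (m0 i)) orbF mxE => /eqP.
by rewrite mulr_ge0 ?sqr_ge0 // ltW.
Qed.

End Spectral.

(** * Sorted lists of real roots with multiplicity *)

Section RootList.
Variable R : rcfType.
Implicit Types (p q : {poly R}) (a K : R).

(** The list underlying [eigenvalues], taken for an arbitrary polynomial so that factorizations can
    be used. *)
Definition root_list p := flatten [seq nseq (mup a p) a | a <- rootsR p].

Lemma mem_rootsR p a : p != 0 -> (a \in rootsR p) = root p a.
Proof. by move=> p0; rewrite -(roots_on_rootsR p0). Qed.

(** Together with sortedness, these multiplicities determine the list. *)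
Lemma count_root_list p a : p != 0 -> count_mem a (root_list p) = mup a p.
Proof.
move=> p0.
have flattenE s : uniq s ->
    count_mem a (flatten [seq nseq (mup b p) b | b <- s]) = ((a \in s) * mup a p)%N.
  elim: s => //= b s IHs /andP[bs us]; rewrite count_cat count_nseq IHs //= [in RHS]in_cons (eq_sym a).
  by case: eqVneq => [<-|]; rewrite ?(negPf bs) /= ?mul0n ?addn0 ?mul1n.
rewrite flattenE ?lt_sorted_uniq ?sorted_roots // mem_rootsR //.
by have [|/mupNroot ->] := boolP (root p a); rewrite ?mul1n.
Qed.

Lemma root_list_sorted p : sorted <=%R (root_list p).
Proof.
rewrite /root_list; have := sorted_roots (- cauchy_bound p) (cauchy_bound p) p.
rewrite -/(rootsR p) !sorted_pairwise; [|exact: le_trans|exact: lt_trans].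
elim: (rootsR p) => //= a s IHs /andP[/allP sa /IHs s_le]; rewrite pairwise_cat s_le andbT.
apply/andP; split; last by elim: (mup a p) => //= k ->; rewrite andbT; apply/allP => x /nseqP[->].
apply/allrelP => x y /nseqP[-> _] /flattenP[_ /mapP[b bs ->]] /nseqP[-> _].
exact/ltW/sa.
Qed.

Lemma mem_root_list p a : p != 0 -> (a \in root_list p) = root p a.
Proof.
by move=> p0; rewrite -has_pred1 has_count count_root_list // -XsubC_dvd // dvdp_XsubCl.
Qed.

Lemma root_list_ge q K : q != 0 -> (forall a, root q a -> K <= a) ->
  all (>= K) (root_list q).
Proof. by move=> q0 rootq; apply/allP => a; rewrite mem_root_list // => /rootq. Qed.

Lemma mup_polyX a : mup a 'X = (0 == a).
Proof.
have := @mup_XsubCX R 1 a 0; rewrite expr1 subr0 => ->.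
by case: (0 == a).
Qed.

(** A root of [q] below [K] would, with the root 0 of ['X], put two entries below [K] in a sorted
    list whose second entry is at least [K]. *)
Lemma root_list_XM_ge q K : q != 0 -> 0 < K -> K <= nth 0 (root_list ('X * q)) 1 ->
  forall a, root q a -> K <= a.
Proof.
move=> q0 K0 Kle a; rewrite -mem_root_list // => aq.
have Xq : perm_eq (root_list ('X * q)) (0 :: root_list q).
  apply/allP => b _ /=; rewrite !count_root_list ?mulf_neq0 ?polyX_eq0 //.
  by rewrite mupM ?polyX_eq0 // mup_polyX.
rewrite leNgt; apply/negP => aK.
have : (1 < count (< K) (root_list ('X * q)))%N.
  by rewrite (permP Xq) /= K0 ltnS -has_count; apply/hasP; exists a.
move: (root_list_sorted ('X * q)) Kle.
(* With fewer than two entries, [nth] would return the default 0, against [0 < K]. *)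
case: (root_list _) => [|b [|c s]] /=; rewrite ?(lt_geF K0) // => /andP[_ cs] Kc.
have -> : count (< K) s = 0%N.
  apply/eqP; rewrite -leqn0 leqNgt -has_count; apply/hasPn => x xs /=.
  by rewrite -leNgt (le_trans Kc) //; move/allP: (order_path_min le_trans cs); apply.
by rewrite (le_gtF Kc) !addn0; case: (_ < _).
Qed.

(** The list made of 0, [k] copies of [K] and the roots of [q] is already sorted and has the
    multiplicities of the product. *)
Lemma root_list_XMXsubC_exp q K k : q != 0 -> 0 < K -> (forall a, root q a -> K <= a) ->
  forall i, (i <= k)%N ->
    nth 0 (root_list ('X * ('X - K%:P) ^+ k * q)) i = if i == 0 then 0 else K.
Proof.
move=> q0 K0 rootq i ik.
have XK0 : ('X - K%:P) ^+ k != 0 by rewrite expf_neq0 // polyXsubC_eq0.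
suff -> : root_list ('X * ('X - K%:P) ^+ k * q) = 0 :: nseq k K ++ root_list q.
  case: i ik => //= i ik; rewrite nth_cat size_nseq ik nth_nseq ik //.
apply: (sorted_eq le_trans le_anti); first exact: root_list_sorted.
  have /allP qK := root_list_ge q0 rootq.
  have qs : pairwise <=%R (root_list q) by rewrite -(sorted_pairwise le_trans) root_list_sorted.
  rewrite (sorted_pairwise le_trans) /= pairwise_cat all_cat qs andbT.
  apply/and3P; split.
  - apply/andP; split; first by apply/allP => x /nseqP[-> _]; exact: ltW.
    by apply/allP => x /qK /=; apply: le_trans; exact: ltW.
  - by apply/allrelP => x y /nseqP[-> _] /qK.
  - by elim: (k) => //= l ->; rewrite andbT; apply/allP => x /nseqP[->].
apply/allP => b _ /=; rewrite count_cat !count_root_list ?mulf_neq0 ?polyX_eq0 //.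
rewrite !mupM ?mulf_neq0 ?polyX_eq0 // mup_polyX mup_XsubCX.
by rewrite count_nseq /= mulnbl addnA.
Qed.

End RootList.

(** * Operators given by a kernel, self-adjoint for a weight and vanishing on constants *)

Section KernelOperator.
Variables (R : realType) (X : finType) (T : {ffun X -> R} -> {ffun X -> R}).
Variables (k : X -> X -> R) (m : X -> R).
Hypothesis TE : forall u x, T u x = \sum_y k x y * u y.
Hypothesis m_gt0 : forall x, 0 < m x.

Let sum_enum_val (F : X -> R) : \sum_(i < #|X|) F (enum_val i) = \sum_x F x.
Proof. by rewrite [RHS](reindex (@enum_val X X)) //; apply/onW_bij/enum_val_bij. Qed.

Lemma op_mxE i j : op_mx T i j = k (enum_val j) (enum_val i).
Proof.
rewrite mxE TE (bigD1 (enum_val i)) //= ffunE eqxx mulr1 big1 ?addr0 // => y.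
by rewrite ffunE => /negPf ->; rewrite mulr0.
Qed.

Lemma mul_op_mx (u : {ffun X -> R}) j :
  ((\row_i u (enum_val i)) *m op_mx T) 0 j = T u (enum_val j).
Proof.
rewrite mxE TE -sum_enum_val; apply: eq_bigr => i _.
by rewrite op_mxE mxE mulrC.
Qed.

(** For [x] in [S], the indicator of [x] minus [c x] times that of [b] is an eigenfunction for [a];
    putting these in place of the indicators of [S] is an invertible change of basis. *)
Lemma char_poly_op_mx_exp_dvd (S : {set X}) (b : X) (c : X -> R) a : b \notin S ->
  (forall x z, x \in S -> k z x - c x * k z b = a * ((z == x)%:R - c x * (z == b)%:R)) ->
  ('X - a%:P) ^+ #|S| %| char_poly (op_mx T).
Proof.
move=> bS eigS.
(* The rows of [1%:M - N] are the new basis; since [b] lies outside [S], [N] squares to zero and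
   [1%:M + N] is the inverse. *)
pose N : 'M[R]_#|X| := \matrix_(i, j)
  ((enum_val i \in S)%:R * c (enum_val i) * (enum_val j == b)%:R).
have NE i j : N i j = (enum_val i \in S)%:R * c (enum_val i) * (enum_val j == b)%:R by rewrite mxE.
have NM (M : 'M[R]_#|X|) i j : (N *m M) i j =
    (enum_val i \in S)%:R * c (enum_val i) * M (enum_rank b) j.
  rewrite mxE (bigD1 (enum_rank b)) //= NE enum_rankK eqxx mulr1 big1 ?addr0 // => l.
  rewrite NE -(inj_eq enum_val_inj) enum_rankK => /negPf ->.
  by rewrite mulr0 mul0r.
have NN : N *m N = 0.
  apply/matrixP => i j; rewrite NM NE enum_rankK (negPf bS) [RHS]mxE.
  by rewrite !mul0r mulr0.
have Pu : 1%:M - N \in unitmx.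
  apply: (mulmx1_unit (B := 1%:M + N) _).1.
  by rewrite mulmxDr mulmx1 mulmxBl mul1mx NN subr0 addrNK.
have PM (M : 'M[R]_#|X|) i j : enum_val i \in S ->
    ((1%:M - N) *m M) i j = M i j - c (enum_val i) * M (enum_rank b) j.
  by move=> iS; rewrite mulmxBl mul1mx [LHS]mxE [X in _ + X]mxE NM iS mul1r.
have -> : #|S| = #|(@enum_val X X) @^-1: S|.
  by rewrite on_card_preimset //; apply/onW_bij/enum_val_bij.
apply: char_poly_exp_dvd Pu _ => i; rewrite inE => iS; apply/rowP => j.
rewrite -[in RHS](mulmx1 (1%:M - N)) [LHS]mxE [RHS]mxE [X in _ * X]mxE !PM //.
by rewrite !op_mxE !enum_rankK eigS // !mxE -!(inj_eq enum_val_inj) enum_rankK !(eq_sym _ (enum_val j)).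
Qed.

Hypothesis m_sym : forall x y, m x * k x y = m y * k y x.
Hypothesis k_sum : forall x, \sum_y k x y = 0.
Variable x0 : X.

Let vol := \sum_x m x.

Lemma sum_weight_gt0 : 0 < vol.
Proof.
rewrite /vol (bigD1 x0) //=; apply: ltr_pwDl => //.
by apply: sumr_ge0 => x _; apply: ltW.
Qed.

Lemma char_poly_op_mx_X : exists2 q, q != 0 & char_poly (op_mx T) = 'X * q.
Proof.
have p0 := monic_neq0 (char_poly_monic (op_mx T)).
have /eqP : const_mx 1 *m op_mx T = 0 :> 'rV_#|X|.
  apply/rowP => j; rewrite !mxE -[RHS](k_sum (enum_val j)) -sum_enum_val.
  by apply: eq_bigr => i _; rewrite op_mxE mxE mul1r.
move=> oneA; have : root (char_poly (op_mx T)) 0.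
  rewrite -eigenvalue_root_char; apply/eigenvalueP; exists (const_mx 1).
    by rewrite (eqP oneA) scale0r.
  apply/eqP => /rowP/(_ (enum_rank x0)); rewrite !mxE => /eqP.
  by rewrite oner_eq0.
rewrite -dvdp_XsubCl subr0 => /dvdpP[q qE].
exists q; last by rewrite qE mulrC.
by apply: contraNneq p0 => q0; rewrite qE q0 mul0r.
Qed.

(** Adds [K] times the [m]-orthogonal projection onto constants: their eigenvalue moves from 0 to
    [K] and the rest of the spectrum stays, so a bound off the constants becomes a bound on a whole
    spectrum. *)
Let deflated K := op_mx T + K *: ((\col_i (m (enum_val i) / vol)) *m const_mx 1).

Lemma char_poly_deflated K q : char_poly (op_mx T) = 'X * q ->
  char_poly (deflated K) = q * ('X - K%:P).
Proof.
move=> pE; apply: (mulIf (x := 'X)); first by rewrite polyX_eq0.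
rewrite char_poly_deflation; last 2 first.
- apply/rowP => j; rewrite !mxE -[RHS](k_sum (enum_val j)) -sum_enum_val.
  by apply: eq_bigr => i _; rewrite op_mxE mxE mul1r.
- rewrite mxE; under eq_bigr do rewrite !mxE mul1r.
  by rewrite (sum_enum_val (fun x => m x / vol)) -mulr_suml divff // gt_eqF // sum_weight_gt0.
by rewrite pE -mulrA mulrC.
Qed.

Let deflated_sym K i j :
  deflated K i j * m (enum_val j) = deflated K j i * m (enum_val i).
Proof.
rewrite !mxE !big_ord1 !mxE !mulr1 !TE.
have E y z : \sum_x k y x * [ffun x => (x == z)%:R : R] x = k y z.
  rewrite (bigD1 z) //= ffunE eqxx mulr1 big1 ?addr0 // => x.
  by rewrite ffunE => /negPf ->; rewrite mulr0.
rewrite !E !mulrDl mulrC m_sym [k _ _ * _]mulrC; congr (_ + _); ring.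
Qed.

(** The two identities are paired so that one multirule rewrites both sides of a form inequality;
    the projection contributes the term in the squared mean. *)
Let deflated_form K (v : 'rV[R]_#|X|) (u := [ffun x => v 0 (enum_rank x)] : {ffun X -> R}) :
  (\sum_i v 0 i ^+ 2 * m (enum_val i) = \sum_x u x ^+ 2 * m x) *
  (\sum_i (v *m deflated K) 0 i * v 0 i * m (enum_val i) =
   \sum_x T u x * u x * m x + K * (\sum_x u x * m x) ^+ 2 / vol).
Proof.
have vE : v = \row_i u (enum_val i) by apply/rowP => i; rewrite mxE ffunE enum_valK.
have ui i : v 0 i = u (enum_val i) by rewrite ffunE enum_valK.
split; first by under eq_bigr do rewrite ui; apply: (sum_enum_val (fun x => u x ^+ 2 * m x)).
have vDe i : (v *m deflated K) 0 i = T u (enum_val i) + K * (\sum_x u x * m x) / vol.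
  rewrite mulmxDr [LHS]mxE {1}vE mul_op_mx; congr (_ + _).
  rewrite -scalemxAr mulmxA mxE mxE big_ord1 [X in _ * (_ * X)]mxE mulr1 mxE -mulrA.
  congr (_ * _); rewrite -sum_enum_val mulr_suml; apply: eq_bigr => j _.
  by rewrite mxE ui mulrA.
under eq_bigr do rewrite vDe ui.
rewrite (sum_enum_val (fun x => (T u x + K * (\sum_x u x * m x) / vol) * u x * m x)).
have -> : K * (\sum_x u x * m x) ^+ 2 / vol =
    \sum_x (K * (\sum_x u x * m x) / vol) * (u x * m x).
  by rewrite -mulr_sumr; ring.
by rewrite -big_split /=; apply: eq_bigr => x _; ring.
Qed.

(** A Poincare inequality: the bound on the second eigenvalue passes to all roots of the cofactor
    [q], hence to the whole spectrum of [deflated K]. *)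
Lemma form_ge_of_eigenvalue K (u : {ffun X -> R}) :
  0 < K -> K <= nth 0 (eigenvalues T) 1 ->
  K * \sum_x u x ^+ 2 * m x <=
    \sum_x T u x * u x * m x + K * (\sum_x u x * m x) ^+ 2 / vol.
Proof.
move=> K0 Kle; have [q q0 pE] := char_poly_op_mx_X.
have rootq : forall a, root q a -> K <= a.
  by apply: root_list_XM_ge => //; rewrite -pE.
have := @selfadjoint_form_ge _ _ (deflated K) (fun i => m (enum_val i)) K
  (\row_i u (enum_val i)) (fun i => m_gt0 _) (deflated_sym K).
rewrite (char_poly_deflated _ pE) !(deflated_form K).
have -> : [ffun x => (\row_i u (enum_val i)) 0 (enum_rank x)] = u.
  by apply/ffunP => x; rewrite ffunE mxE enum_rankK.
apply=> a; rewrite rootM => /orP[/rootq //|]; rewrite root_XsubC => /eqP ->.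
exact: lexx.
Qed.

(** The constants supply a factor ['X], the eigenfunctions indexed by [S] supply [#|S|] factors
    ['X - K], and the form inequality keeps every remaining root at or above [K]. *)
Lemma eigenvalues_of_form_ge K (S : {set X}) (b : X) (c : X -> R) : 0 < K ->
  (forall u : {ffun X -> R}, K * \sum_x u x ^+ 2 * m x <=
    \sum_x T u x * u x * m x + K * (\sum_x u x * m x) ^+ 2 / vol) ->
  b \notin S ->
  (forall x z, x \in S -> k z x - c x * k z b = K * ((z == x)%:R - c x * (z == b)%:R)) ->
  forall i, (i <= #|S|)%N -> nth 0 (eigenvalues T) i = if i == 0 then 0 else K.
Proof.
move=> K0 formT bS eigS.
have := char_poly_op_mx_exp_dvd bS eigS; have [q q0 pE] := char_poly_op_mx_X.
(* Since [K] is nonzero, the power of ['X - K] is coprime to ['X] and divides the cofactor [q]. *)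
rewrite pE Gauss_dvdpr; last first.
  by rewrite coprimep_expl // coprimep_sym coprimep_XsubC rootX gt_eqF.
move=> /dvdpP[q' qE].
have q'0 : q' != 0 by apply: contraNneq q0 => q'0; rewrite qE q'0 mul0r.
rewrite /eigenvalues /= -[flatten _]/(root_list _) pE qE [q' * _]mulrC mulrA.
apply: root_list_XMXsubC_exp => // a q'a.
(* Roots of [q'] are also eigenvalues of [deflated K], whose form is the right-hand side of the
   assumed inequality. *)
apply: (@root_char_poly_ge _ _ (deflated K) (fun i => m (enum_val i)) K (fun i => m_gt0 _)).
  by move=> v; rewrite !(deflated_form K).
by rewrite (char_poly_deflated _ pE) qE !rootM q'a.
Qed.

End KernelOperator.

(** * The Laplacian and its Dirichlet form *)

Lemma sum_delta (R : pzSemiRingType) (I : finType) (F : I -> R) i :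
  \sum_j (i == j)%:R * F j = F i.
Proof.
rewrite (bigD1 i) //= eqxx mul1r big1 ?addr0 // => j.
by rewrite eq_sym => /negPf ->; rewrite mul0r.
Qed.

Section Laplacian.
Variables (R : realType) (V : finType) (G : wgraph R V).
Implicit Types (u : {ffun V -> R}) (x y : V).
Let m := vmeas G.
Let w := ewgt G.

Definition laplacian_kernel x y : R :=
  (m x)^-1 * ((x == y)%:R * (\sum_z w x z) - w x y).

Lemma neg_laplacian_kernelE u x : neg_laplacian G u x = \sum_y laplacian_kernel x y * u y.
Proof.
rewrite !ffunE -mulrN; under [RHS]eq_bigr do rewrite -mulrA.
rewrite -mulr_sumr; congr (_ * _).
under [RHS]eq_bigr do rewrite mulrBl -mulrA; rewrite sumrB sum_delta.
by rewrite mulr_suml -sumrB -sumrN; apply: eq_bigr => y _; rewrite /w; ring.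
Qed.

Lemma laplacian_kernel_sym x y : m x * laplacian_kernel x y = m y * laplacian_kernel y x.
Proof.
rewrite !mulrA !divff ?gt_eqF ?vmeas_gt0 // !mul1r eq_sym (_ : w x y = w y x); last exact: ewgt_sym.
by case: eqVneq => [->|] //; rewrite !mul0r.
Qed.

Lemma laplacian_kernel_sum x : \sum_y laplacian_kernel x y = 0.
Proof.
by rewrite -mulr_sumr sumrB sum_delta subrr mulr0.
Qed.

(** Green's formula: exchanging [x] and [y] by symmetry of the weights and averaging produces the
    square, with every edge counted twice. *)
Lemma laplacian_form u : \sum_x neg_laplacian G u x * u x * m x =
  (\sum_x \sum_y w x y * (u x - u y) ^+ 2) / 2.
Proof.
have E1 : \sum_x neg_laplacian G u x * u x * m x = \sum_x \sum_y w x y * (u x - u y) * u x.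
  apply: eq_bigr => x _; rewrite !ffunE -/(m x).
  have m0 : m x != 0 by rewrite gt_eqF ?vmeas_gt0.
  transitivity (- (\sum_y (u y - u x) * ewgt G x y) * u x); first by field.
  by rewrite -sumrN mulr_suml; apply: eq_bigr => y _; rewrite /w; ring.
have E2 : \sum_x \sum_y w x y * (u x - u y) * u x = \sum_x \sum_y w x y * (u y - u x) * u y.
  rewrite exchange_big; apply: eq_bigr => x _; apply: eq_bigr => y _.
  by rewrite /w ewgt_sym.
have E3 : \sum_x \sum_y w x y * (u x - u y) ^+ 2 =
    \sum_x \sum_y w x y * (u x - u y) * u x + \sum_x \sum_y w x y * (u y - u x) * u y.
  rewrite -big_split; apply: eq_bigr => x _; rewrite -big_split; apply: eq_bigr => y _ /=.
  ring.
by rewrite E1 E3 -E2; field.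
Qed.

Lemma ewgt_ge0 x y : 0 <= w x y.
Proof.
have [/ewgt_gt0/ltW //|/ewgt_eq0 xy] := boolP (edge G x y).
by rewrite /w xy.
Qed.

Lemma laplacian_form_ge0 u : 0 <= \sum_x neg_laplacian G u x * u x * m x.
Proof.
rewrite laplacian_form divr_ge0 ?ler0n //.
by apply: sumr_ge0 => x _; apply: sumr_ge0 => y _; rewrite mulr_ge0 ?sqr_ge0 ?ewgt_ge0.
Qed.

(** Every term of the energy vanishes, so [u] agrees across edges and then along paths; this yields
    uniqueness of the harmonic extension. *)
Lemma laplacian_form_eq0 u : connected_wgraph G ->
  \sum_x neg_laplacian G u x * u x * m x = 0 -> forall x y, u x = u y.
Proof.
move=> Gconn form0 x y.
have uedge s t : edge G s t -> u s = u t.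
  move=> st; move/eqP: form0; rewrite laplacian_form mulf_eq0 invr_eq0 pnatr_eq0 orbF.
  have pos a b : 0 <= w a b * (u a - u b) ^+ 2 by rewrite mulr_ge0 ?sqr_ge0 ?ewgt_ge0.
  rewrite psumr_eq0 => [/allP/(_ s (mem_index_enum _))|a _]; last by apply: sumr_ge0.
  rewrite /= psumr_eq0 => [/allP/(_ t (mem_index_enum _))|b _] //=.
  by rewrite mulf_eq0 (gt_eqF (ewgt_gt0 st)) expf_eq0 /= subr_eq0 => /eqP.
have /connectP[p] := Gconn x y.
elim: p x => [|z p IHp] x /=; first by move=> _ ->.
by move=> /andP[/uedge -> /IHp h] /h.
Qed.

End Laplacian.

(** * Weighted sums: Cauchy-Schwarz, moments and variance *)

(** The squared norm of [Q p - s q] equals [Q (P Q - s^2)]; if [Q] vanishes, so do [q] and [s]. *)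
Lemma weighted_cauchy_schwarz (R : realFieldType) (I : finType) (n p q : I -> R) :
  (forall i, 0 < n i) ->
  (\sum_i p i * q i * n i) ^+ 2 <= (\sum_i p i ^+ 2 * n i) * (\sum_i q i ^+ 2 * n i).
Proof.
move=> n0; set s := \sum_i _; set P := \sum_i _; set Q := \sum_i _.
have Q0 : 0 <= Q by apply: sumr_ge0 => i _; rewrite mulr_ge0 ?sqr_ge0 // ltW.
have := Q0; rewrite le_eqVlt => /orP[/eqP Qz|Qp].
  suff -> : s = 0 by rewrite expr0n -Qz mulr0.
  apply: big1 => i _; move/esym/eqP: Qz; rewrite psumr_eq0 => [/allP/(_ i (mem_index_enum _))|j _].
    by rewrite /= mulf_eq0 (gt_eqF (n0 i)) expf_eq0 orbF /= => /eqP ->; rewrite mulr0 mul0r.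
  by rewrite mulr_ge0 ?sqr_ge0 // ltW.
have : 0 <= \sum_i (Q * p i - s * q i) ^+ 2 * n i.
  by apply: sumr_ge0 => i _; rewrite mulr_ge0 ?sqr_ge0 // ltW.
have E a b : \sum_i (a * p i - b * q i) ^+ 2 * n i = a ^+ 2 * P - 2 * a * b * s + b ^+ 2 * Q.
  by rewrite /P /s /Q !mulr_sumr -sumrB -big_split; apply: eq_bigr => i _ /=; ring.
rewrite E.
have -> : Q ^+ 2 * P - 2 * Q * s * s + s ^+ 2 * Q = Q * (P * Q - s ^+ 2) by ring.
by rewrite pmulr_rge0 // subr_ge0.
Qed.

(** Because the weight factors, the energy across the boundary reduces to a few moments on either
    side. *)
Lemma sum_sqr_sub (R : comRingType) (I J : finType) (p m : I -> R) (q r n : J -> R) :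
  \sum_i \sum_j r j * m i * n j * (p i - q j) ^+ 2 =
  (\sum_i p i ^+ 2 * m i) * (\sum_j r j * n j)
  - 2 * (\sum_i p i * m i) * (\sum_j r j * q j * n j)
  + (\sum_i m i) * (\sum_j r j * q j ^+ 2 * n j).
Proof.
rewrite -mulrA !mulr_suml mulr_sumr -sumrB -big_split; apply: eq_bigr => i _ /=.
rewrite !mulr_sumr -sumrB -big_split; apply: eq_bigr => j _ /=; ring.
Qed.

(** Both sides are [M] times the variance, which is translation invariant. *)
Lemma variance_shift (R : fieldType) (I : finType) (m u : I -> R) a (M := \sum_i m i) : M != 0 ->
  \sum_i (u i - a) ^+ 2 * m i - (\sum_i (u i - a) * m i) ^+ 2 / M =
  \sum_i u i ^+ 2 * m i - (\sum_i u i * m i) ^+ 2 / M.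
Proof.
move=> M0.
have -> : \sum_i (u i - a) ^+ 2 * m i =
    \sum_i u i ^+ 2 * m i - 2 * a * (\sum_i u i * m i) + a ^+ 2 * M.
  by rewrite /M !mulr_sumr -sumrB -big_split; apply: eq_bigr => i _ /=; ring.
have -> : \sum_i (u i - a) * m i = \sum_i u i * m i - a * M.
  by rewrite /M mulr_sumr -sumrB; apply: eq_bigr => i _ /=; ring.
by field.
Qed.

Lemma fmin_le (R : realType) (X : finType) (f : {ffun X -> R}) y : fmin f <= f y.
Proof.
rewrite /fmin; case: pickP => [y0 _|/(_ y)//].
by case: arg_minP => // z _; apply.
Qed.

Lemma sum_vset_setC (R : nmodType) (V : finType) (B : {set V}) (F : V -> R) :
  \sum_x F x = \sum_(x : vset B) F (val x) + \sum_(y : vset (~: B)) F (val y).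
Proof.
rewrite (bigID (mem B)) /=; congr (_ + _); first exact: big_sub.
rewrite (eq_bigl (fun x => x \in ~: B)); first exact: big_sub.
by move=> x; rewrite inE.
Qed.

(** * Spectra of a graph whose boundary weights factor through [rho] *)

Section Boundary.
Variables (R : realType) (V : finType) (G : wgraph R V) (B : {set V}).
Variable rho : {ffun vset (~: B) -> R}.
Hypothesis Gconn : connected_wgraph G.
Hypothesis GB : is_boundary G B.
Hypothesis rho_ge0 : forall y, 0 <= rho y.
Hypothesis wE : forall (x : vset B) (y : vset (~: B)),
  ewgt G (val x) (val y) = rho y * vmeas G (val x) * vmeas G (val y).

Let Om := induced G (~: B).
Let m := vmeas G.
Let Deg := \sum_y rho y * m (val y).
Let VB := \sum_(x : vset B) m (val x).
Let VG := \sum_x m x.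

Lemma vset_boundary : vset B.
Proof.
case: GB => /set0Pn B0 _ _; apply: (@xchoose _ xpredT).
by have [x xB] := B0; exists (Sub x xB).
Qed.

(** A boundary vertex has an interior neighbour, and the positive weight of that edge forces [rho]
    to be positive there. *)
Lemma boundary_degree_gt0 : 0 < Deg.
Proof.
have [_ _ /(_ _ (valP vset_boundary))[y yB xy]] := GB.
pose yo : vset (~: B) := Sub y yB.
have := ewgt_gt0 xy; rewrite (wE vset_boundary yo) pmulr_lgt0 ?vmeas_gt0 //.
rewrite pmulr_lgt0 ?vmeas_gt0 // => rho_gt0.
rewrite /Deg (bigD1 yo) //=; apply: ltr_pwDl; first by rewrite mulr_gt0 ?vmeas_gt0.
by apply: sumr_ge0 => z _; rewrite mulr_ge0 ?rho_ge0 // ltW ?vmeas_gt0.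
Qed.

Lemma vset_interior : vset (~: B).
Proof.
apply: (@xchoose _ xpredT).
have [_ _ /(_ _ (valP vset_boundary))[y yB _]] := GB.
by exists (Sub y yB).
Qed.

Lemma ewgt_boundary0 (x x' : vset B) : ewgt G (val x) (val x') = 0.
Proof. by case: GB => _ nadj _; apply: ewgt_eq0; apply: nadj; apply: valP. Qed.

(** Boundary vertices are pairwise non-adjacent, and each boundary-interior pair occurs in both
    orders, which cancels the factor one half. *)
Lemma laplacian_form_boundary (u : {ffun V -> R}) :
  \sum_x neg_laplacian G u x * u x * m x =
  \sum_(x : vset B) \sum_(y : vset (~: B))
    rho y * m (val x) * m (val y) * (u (val x) - u (val y)) ^+ 2
  + \sum_y neg_laplacian Om [ffun y => u (val y)] y
      * [ffun y => u (val y)] y * vmeas Om y.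
Proof.
rewrite !laplacian_form.
have E1 : \sum_(x : vset B) \sum_y ewgt G (val x) y * (u (val x) - u y) ^+ 2 =
  \sum_(x : vset B) \sum_(y : vset (~: B))
    rho y * m (val x) * m (val y) * (u (val x) - u (val y)) ^+ 2.
  apply: eq_bigr => x _; rewrite (sum_vset_setC B) big1 ?add0r => [|x' _]; last first.
    by rewrite ewgt_boundary0 mul0r.
  by apply: eq_bigr => y _; rewrite wE.
have E2 : \sum_(y : vset (~: B)) \sum_x ewgt G (val y) x * (u (val y) - u x) ^+ 2 =
  \sum_(x : vset B) \sum_(y : vset (~: B))
    rho y * m (val x) * m (val y) * (u (val x) - u (val y)) ^+ 2
  + \sum_(y : vset (~: B)) \sum_(z : vset (~: B))
      ewgt G (val y) (val z) * (u (val y) - u (val z)) ^+ 2.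
  rewrite [X in _ = X + _]exchange_big -big_split; apply: eq_bigr => y _ /=.
  rewrite (sum_vset_setC B); congr (_ + _); apply: eq_bigr => x _.
  by rewrite ewgt_sym wE -(opprB (u _)) sqrrN.
rewrite (sum_vset_setC B) E1 E2.
have -> : \sum_x \sum_y ewgt Om x y *
    ([ffun y => u (val y)] x - [ffun y => u (val y)] y) ^+ 2 =
  \sum_(y : vset (~: B)) \sum_(z : vset (~: B))
      ewgt G (val y) (val z) * (u (val y) - u (val z)) ^+ 2.
  by apply: eq_bigr => x _; apply: eq_bigr => y _; rewrite !ffunE.
by field.
Qed.

Lemma VG_gt0 : 0 < VG.
Proof. exact: (sum_weight_gt0 (vmeas_gt0 G) (val vset_boundary)). Qed.

Lemma VB_gt0 : 0 < VB.
Proof. exact: (sum_weight_gt0 (fun x : vset B => vmeas_gt0 G (val x)) vset_boundary). Qed.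

Lemma interior_form_ge K (u : {ffun vset (~: B) -> R}) :
  (K%:E <= mu2 Om)%E -> \sum_y u y * m (val y) = 0 ->
  K * (\sum_y u y ^+ 2 * m (val y)) <= \sum_y neg_laplacian Om u y * u y * vmeas Om y.
Proof.
move=> Kmu u0; have N0 : 0 <= \sum_y u y ^+ 2 * m (val y).
  by apply: sumr_ge0 => y _; rewrite mulr_ge0 ?sqr_ge0 // ltW ?vmeas_gt0.
have E0 := laplacian_form_ge0 Om u.
have [K0|K0] := leP K 0; first by apply: le_trans E0; rewrite mulr_le0_ge0.
(* On a one-vertex interior [mu2] is infinite, but a function of zero mean vanishes there. *)
move: Kmu; rewrite /mu2; case: eqVneq => [card1 _|_].
  have [y0 yE] := fintype1 card1.
  have uy y : u y = 0.
    move: u0; rewrite (yE y) (bigD1 y0) //= big1 => [|z]; last by rewrite (yE z) eqxx.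
    by rewrite addr0 => /eqP; rewrite mulf_eq0 (gt_eqF (vmeas_gt0 _ _)) orbF => /eqP.
  by rewrite big1 ?mulr0 // => y _; rewrite uy expr0n mul0r.
rewrite lee_fin => Kle.
have := form_ge_of_eigenvalue (neg_laplacian_kernelE Om) (vmeas_gt0 Om)
  (laplacian_kernel_sym Om) (laplacian_kernel_sum Om) vset_interior u K0 Kle.
by rewrite [\sum_x u x * _]u0 expr0n mulr0 mul0r addr0.
Qed.

(** The Poincare inequality with constant [Deg]: the lower bound on [mu2] pays for the losses in
    Cauchy-Schwarz and in replacing [rho] by its minimum. *)
Lemma boundary_form_ge (u : {ffun V -> R}) :
  ((Deg - VB * fmin rho + VG / Deg * \sum_y rho y ^+ 2 * m (val y))%:E <= mu2 Om)%E ->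
  Deg * \sum_x u x ^+ 2 * m x <=
    \sum_x neg_laplacian G u x * u x * m x + Deg * (\sum_x u x * m x) ^+ 2 / VG.
Proof.
set Q := \sum_y rho y ^+ 2 * _ => hmu.
have VG0 := VG_gt0; have Deg0 := boundary_degree_gt0.
(* [a] is the interior mean; subtracting it changes neither the energy nor the variance, and makes
   the interior first moment vanish. *)
pose a := (\sum_(y : vset (~: B)) u (val y) * m (val y)) / \sum_(y : vset (~: B)) m (val y).
pose u' : {ffun V -> R} := [ffun x => u x - a].
have u'0 : \sum_(y : vset (~: B)) u' (val y) * m (val y) = 0.
  under eq_bigr do rewrite ffunE mulrBl.
  rewrite sumrB -mulr_sumr divfK ?subrr // gt_eqF //.
  exact: (sum_weight_gt0 (fun x : vset (~: B) => vmeas_gt0 G (val x)) vset_interior).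
have var := variance_shift u a (lt0r_neq0 VG0).
have -> : \sum_x neg_laplacian G u x * u x * m x = \sum_x neg_laplacian G u' x * u' x * m x.
  rewrite !laplacian_form; congr (_ / _); apply: eq_bigr => x _; apply: eq_bigr => y _.
  by rewrite !ffunE; congr (_ * _ ^+ 2); ring.
rewrite -lerBlDr -mulrA -mulrBr -var mulrBr lerBlDr mulrA.
have -> : \sum_x (u x - a) ^+ 2 * m x = \sum_x u' x ^+ 2 * m x.
  by apply: eq_bigr => x _; rewrite ffunE.
have -> : \sum_x (u x - a) * m x = \sum_x u' x * m x.
  by apply: eq_bigr => x _; rewrite ffunE.
rewrite -/VG laplacian_form_boundary !(sum_vset_setC B) u'0 addr0 sum_sqr_sub -/Deg -/VB.
have uO : \sum_y [ffun y : vset (~: B) => u' (val y)] y * m (val y) = 0.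
  by rewrite -[RHS]u'0; apply: eq_bigr => y _; rewrite ffunE.
have := interior_form_ge hmu uO; set E := \sum_x neg_laplacian _ _ _ * _ * _.
have -> : \sum_y [ffun y : vset (~: B) => u' (val y)] y ^+ 2 * m (val y) =
   \sum_(y : vset (~: B)) u' (val y) ^+ 2 * m (val y).
  by apply: eq_bigr => y _; rewrite ffunE.
have CS := weighted_cauchy_schwarz rho (fun y => u' (val y))
  (fun y : vset (~: B) => vmeas_gt0 G (val y)).
have W : fmin rho * (\sum_(y : vset (~: B)) u' (val y) ^+ 2 * m (val y)) <=
    \sum_(y : vset (~: B)) rho y * u' (val y) ^+ 2 * m (val y).
  rewrite mulr_sumr; apply: ler_sum => y _; rewrite mulrA ler_pM2r ?vmeas_gt0 //.
  by apply: ler_wpM2r; [exact: sqr_ge0 | exact: fmin_le].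
move: CS W; rewrite -/m -/Q.
move: (\sum_y rho y * u' (val y) * _) (\sum_y rho y * u' (val y) ^+ 2 * _)
  (\sum_(y : vset (~: B)) u' (val y) ^+ 2 * _) (\sum_(x : vset B) u' (val x) ^+ 2 * _)
  (\sum_(x : vset B) u' (val x) * _) => s W N P2 P1 CS WN EN.
(* Completing the square bounds the cross term [2 * P1 * s] at the cost of [VG / Deg * s ^+ 2],
   which Cauchy-Schwarz then bounds by [VG / Deg * Q * N]. *)
have sq : 0 <= Deg * P1 ^+ 2 / VG - 2 * P1 * s + VG / Deg * s ^+ 2.
  have -> : Deg * P1 ^+ 2 / VG - 2 * P1 * s + VG / Deg * s ^+ 2 =
    (Deg * P1 - VG * s) ^+ 2 / (Deg * VG) by field; rewrite !gt_eqF.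
  by rewrite divr_ge0 ?sqr_ge0 // mulr_ge0 // ltW.
have CS' : VG / Deg * s ^+ 2 <= VG / Deg * Q * N.
  by rewrite -(mulrA (VG / Deg)) ler_pM2l // divr_gt0.
have WN' : VB * (fmin rho * N) <= VB * W by rewrite ler_pM2l ?VB_gt0.
(* The terms in [P2] cancel, and the four bounds add up to the remaining [Deg * N]. *)
move: EN sq CS' WN'; move: (VG / Deg) (Deg * P1 ^+ 2 / VG) => r t. lra.
Qed.

(** Kernel of [Deg] times the projection that subtracts the boundary mean. *)
Definition DtN_kernel (x y : vset B) : R := Deg * ((x == y)%:R - m (val y) / VB).

(** The harmonic extension is constant on the interior, equal to the boundary mean [c]: at an
    interior vertex the boundary terms are proportional to the deviations from [c], which sum to
    zero against [m]. *)
Lemma DtN_kernelE f x : DtN G f x = \sum_y DtN_kernel x y * f y.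
Proof.
pose c := (\sum_y f y * m (val y)) / VB.
have VB0 : VB != 0 by rewrite gt_eqF ?VB_gt0.
pose h : {ffun V -> R} := [ffun x => if insub x is Some x' then f x' else c].
have hB (z : vset B) : h (val z) = f z by rewrite ffunE valK.
have hO (z : vset (~: B)) : h (val z) = c.
  by rewrite ffunE insubN //; have := valP z; rewrite inE.
have hharm : is_harmonic_ext G f h.
  split=> // y yB; pose yo : vset (~: B) := Sub y yB.
  rewrite ffunE (sum_vset_setC B) [X in _ + X]big1 => [|z _]; last first.
    by rewrite (hO z) (hO yo) subrr mul0r.
  under eq_bigr do rewrite hB (hO yo) ewgt_sym (wE _ yo).
  have -> : \sum_(z : vset B) (f z - c) * (rho yo * vmeas G (val z) * vmeas G (val yo)) =
     (rho yo * m (val yo)) * (\sum_z f z * m (val z) - c * VB).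
    rewrite mulrBr !mulr_sumr -sumrB; apply: eq_bigr => z _; rewrite /m; ring.
  by rewrite /c divfK // subrr mulr0 addr0 mulr0.
have -> : DtN G f x = normal_deriv G h (val x).
  rewrite ffunE; congr (normal_deriv G _ _).
  have [eB eO] : is_harmonic_ext G f (harmonic_ext G f) by apply: xgetPex; exists h.
  (* The difference of two extensions vanishes on [B] and is harmonic inside, so its energy is zero
     and it is constant, hence zero. *)
  pose d : {ffun V -> R} := [ffun z => harmonic_ext G f z - h z].
  have dB (z : vset B) : d (val z) = 0 by rewrite ffunE eB hB subrr.
  have dconst : forall s t, d s = d t.
    apply: laplacian_form_eq0 => //; apply: big1 => z _.
    have [zB|zB] := boolP (z \in B); first by rewrite (dB (Sub z zB)) mulr0 mul0r.
    have zO : z \in ~: B by rewrite inE.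
    suff -> : neg_laplacian G d z = 0 by rewrite !mul0r.
    have lin : laplacian G d z = laplacian G (harmonic_ext G f) z - laplacian G h z.
      rewrite !ffunE -mulrBr -sumrB; congr (_ * _); apply: eq_bigr => y _.
      by rewrite !ffunE; ring.
    by rewrite ffunE lin eO // (proj2 hharm) // subrr oppr0.
  apply/ffunP => z; apply/eqP; rewrite -subr_eq0.
  by have := dconst z (val x); rewrite dB ffunE => ->.
rewrite /normal_deriv (sum_vset_setC B) big1 ?add0r => [|z _]; last first.
  by rewrite ewgt_boundary0 mulr0.
under eq_bigr do rewrite hB hO wE.
have -> : \sum_(y : vset (~: B)) (f x - c) * (rho y * vmeas G (val x) * vmeas G (val y)) =
   m (val x) * (Deg * (f x - c)).
  rewrite /Deg mulr_suml mulr_sumr; apply: eq_bigr => y _; rewrite /m; ring.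
rewrite mulKf ?gt_eqF ?vmeas_gt0 //.
rewrite -(sum_delta f x) /c mulr_suml -sumrB mulr_sumr; apply: eq_bigr => y _.
by rewrite /DtN_kernel; ring.
Qed.

Lemma DtN_kernel_sum x : \sum_y DtN_kernel x y = 0.
Proof.
rewrite -mulr_sumr sumrB -mulr_suml divff ?gt_eqF ?VB_gt0 //.
under eq_bigr do rewrite -[_%:R]mulr1.
by rewrite (sum_delta (fun=> 1)) subrr mulr0.
Qed.

Lemma DtN_form (f : {ffun vset B -> R}) : Deg * \sum_x f x ^+ 2 * m (val x) =
  \sum_x DtN G f x * f x * m (val x) + Deg * (\sum_x f x * m (val x)) ^+ 2 / VB.
Proof.
have DtNE x : DtN G f x = Deg * (f x - (\sum_y f y * m (val y)) / VB).
  rewrite DtN_kernelE -[in RHS](sum_delta f x) mulr_suml -sumrB mulr_sumr.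
  by apply: eq_bigr => y _; rewrite /DtN_kernel; ring.
have -> : Deg * (\sum_x f x * m (val x)) ^+ 2 / VB =
    \sum_x (Deg * (\sum_y f y * m (val y)) / VB) * (f x * m (val x)).
  by rewrite -mulr_sumr; ring.
rewrite mulr_sumr -big_split; apply: eq_bigr => x _ /=; rewrite DtNE; ring.
Qed.

(** For [x] other than [b], the indicator of [x] minus [m x / m b] times that of [b] has zero mean;
    this gives [#|B| - 1] eigenfunctions for [Deg]. *)
Lemma nth_eigenvalues_DtN i : (i < #|B|)%N ->
  nth 0 (eigenvalues (@DtN R V G B)) i = if i == 0 then 0 else Deg.
Proof.
move=> iB; pose b := vset_boundary.
apply: (eigenvalues_of_form_ge DtN_kernelE (fun x : vset B => vmeas_gt0 G (val x))
  DtN_kernel_sum b boundary_degree_gt0 (S := [set~ b])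
  (b := b) (c := fun x => m (val x) / m (val b))).
- by move=> u; rewrite [leLHS]DtN_form.
- by rewrite !inE eqxx.
- move=> x z _; have mb : m (val b) != 0 by rewrite gt_eqF ?vmeas_gt0.
  have VB0 : VB != 0 by rewrite gt_eqF ?VB_gt0.
  by rewrite /DtN_kernel; field; rewrite mb.
- by rewrite cardsC1 card_sig -ltnS (ltn_predK iB).
Qed.

Lemma nth_eigenvalues_laplacian i :
  ((Deg - VB * fmin rho + VG / Deg * \sum_y rho y ^+ 2 * m (val y))%:E <= mu2 Om)%E ->
  (i < #|B|)%N ->
  nth 0 (eigenvalues (neg_laplacian G)) i = if i == 0 then 0 else Deg.
Proof.
move=> hmu iB; pose b := vset_boundary.
apply: (eigenvalues_of_form_ge (neg_laplacian_kernelE G) (vmeas_gt0 G)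
  (laplacian_kernel_sum G) (val b) boundary_degree_gt0
  (S := B :\ val b) (b := val b) (c := fun x => m x / m (val b))).
- by move=> u; exact: boundary_form_ge.
- by rewrite !inE eqxx.
- move=> x z; rewrite !inE => /andP[_ xB].
  have mb : m (val b) != 0 by rewrite gt_eqF ?vmeas_gt0.
  have mz : m z != 0 by rewrite gt_eqF ?vmeas_gt0.
  (* At a boundary vertex only the diagonal term remains, equal to [Deg]; at an interior one the
     contributions of [x] and [b] cancel by the choice of [c]. *)
  rewrite /laplacian_kernel -/m; have [zB|zB] := boolP (z \in B).
    have -> : \sum_y ewgt G z y = m z * Deg.
      rewrite (sum_vset_setC B) big1 ?add0r => [|y _]; last exact: (ewgt_boundary0 (Sub z zB)).
      by rewrite mulr_sumr; apply: eq_bigr => y _; rewrite (wE (Sub z zB)) /= /m; ring.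
    rewrite (ewgt_boundary0 (Sub z zB) (Sub x xB)) (ewgt_boundary0 (Sub z zB) b).
    by field; rewrite mb mz.
  have zO : z \in ~: B by rewrite inE.
  have zx : z == x = false by apply: contraNF zB => /eqP ->.
  have zb : z == val b = false by apply: contraNF zB => /eqP ->; exact: valP.
  rewrite zx zb (ewgt_sym G z x) (ewgt_sym G z) (wE (Sub x xB) (Sub z zO)) (wE b (Sub z zO)) /=.
  by rewrite -/m; field; rewrite mb mz.
- by rewrite -ltnS; move: iB; rewrite (cardsD1 (val b)) (valP b).
Qed.

End Boundary.

Theorem corollary1p1 (R : realType) (V : finType) (G : wgraph R V)
    (B : {set V}) (rho : {ffun vset (~: B) -> R}) :
  let Om := induced G (~: B) in
  let Deg := inner Om rho [ffun => 1] in
  let VB := volume G B in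
  let VG := volume G [set: V] in
  connected_wgraph G ->
  is_boundary G B ->
  (forall y, 0 <= rho y) ->
  (forall (x : vset B) (y : vset (~: B)),
     ewgt G (val x) (val y) = rho y * vmeas G (val x) * vmeas G (val y)) ->
  ((Deg - VB * fmin rho + VG / Deg * inner Om rho rho)%:E <= mu2 Om)%E ->
  forall i : nat, (1 <= i <= #|B|)%N ->
    steklov_eig G B i = laplacian_eig G i.
Proof.
(* Numbering from 1 excludes [i = 0]; after the shift both lists are read at an index below
   [#|B|]. *)
move=> Om Deg VB VG Gconn GB rho0 wE hmu [//|i] iB.
have DegE : Deg = \sum_y rho y * vmeas G (val y).
  by apply: eq_bigr => y _; rewrite ffunE mulr1.
have VBE : VB = \sum_(x : vset B) vmeas G (val x) by rewrite /VB /volume big_sub.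
have VGE : VG = \sum_x vmeas G x by apply: eq_bigl => x; rewrite inE.
rewrite DegE VBE VGE in hmu.
rewrite /steklov_eig /laplacian_eig /= (nth_eigenvalues_DtN Gconn GB rho0 wE) //.
by rewrite (nth_eigenvalues_laplacian GB rho0 wE hmu).
Qed.
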